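(* Let $(\chi,\mu)$ be a $\sigma$-finite measure space, let $p,q\in\Omega$ be probability densities with respect to $\mu$, and let $r\in\mathbb{R}$. Define $$r_1=\begin{cases}\min\left\{\frac{r+2}{3},\ \frac{r\ln 2}{\ln(r+1)}\right\}, & r>-1,\ r\ne0,\\[2pt] \min\left\{\frac23,\ \ln 2\right\}, & r=0,\\[2pt] \min\left\{\frac{r+2}{3},\ 0\right\}, & r\le-1,\end{cases}$$ and let $r_2$ be defined in the same way with $\max$ in place of $\min$. Then $$D_{M^{[r_1]}}(p,q)\ \le\ D_{L_r}(p,q)\ \le\ D_{M^{[r_2]}}(p,q).$$
   Context: $\Omega$ is the set of measurable functions $p:\chi\to\mathbb{R}$ with $p(x)\ge 0$ and $\int_\chi p\,d\mu=1$. For $a,b>0$, $a\neq b$, the $t$-logarithmic mean is $$L_t(a,b)=\left[\frac{b^{t+1}-a^{t+1}}{(t+1)(b-a)}\right]^{1/t}\ (t\in\mathbb{R},\ t\ne -1,0),\qquad L_{-1}(a,b)=\frac{b-a}{\ln b-\ln a},\qquad L_0(a,b)=\frac1e\left(\frac{b^b}{a^a}\right)^{\frac1{b-a}},$$ with $L_t(a,a)=a$. For $a,b>0$ the $\alpha$-th power mean is $M^{[\alpha]}(a,b)=\left(\frac{a^\alpha+b^\alpha}{2}\right)^{1/\alpha}$ for $\alpha\in\mathbb{R}\setminus\{0\}$, and $M^{[0]}(a,b)=\sqrt{ab}$. All these means are extended to $[0,\infty)^2$ by continuity. The $L_t$-divergence measure is $D_{L_t}(p,q)=\int_\chi L_t(p(x),q(x))\,d\mu(x)$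 and the $\alpha$-power divergence measure is $D_{M^{[\alpha]}}(p,q)=\int_\chi M^{[\alpha]}(p(x),q(x))\,d\mu(x)$, for $t,\alpha\in\mathbb{R}$. *)

(* Defs.v *)
From mathcomp Require Import all_boot all_order all_algebra.
From mathcomp Require Import all_classical all_reals all_analysis.

Set Implicit Arguments.
Unset Strict Implicit.
Unset Printing Implicit Defensive.

Import Order.TTheory GRing.Theory Num.Theory.
Import numFieldNormedType.Exports.

Local Open Scope classical_set_scope.
Local Open Scope ring_scope.

Definition densities (R : realType) (d : measure_display)
    (T : measurableType d) (mu : {measure set T -> \bar R}) : set (T -> R) :=
  [set p : T -> R | [/\ measurable_fun setT p, (forall x, 0 <= p x) &
               (\int[mu]_x (p x)%:E = 1)%E]].

(* The formula is only meaningful for a, b > 0; see [log_mean]. *)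
Definition log_mean_pos (R : realType) (t a b : R) : R :=
  if a == b then a
  else if t == -1 then (b - a) / (ln b - ln a)
  else if t == 0 then (expR 1)^-1 * ((b `^ b) / (a `^ a)) `^ (b - a)^-1
  else ((b `^ (t + 1) - a `^ (t + 1)) / ((t + 1) * (b - a))) `^ t^-1.

(* The formula is only meaningful for a, b > 0; see [power_mean]. *)
Definition power_mean_pos (R : realType) (alpha a b : R) : R :=
  if alpha == 0 then Num.sqrt (a * b)
  else ((a `^ alpha + b `^ alpha) / 2) `^ alpha^-1.

(* Extension by continuity from the open quadrant to [0, +oo[ x [0, +oo[ :
   on the boundary, the value is the limit of [m] along points of the open
   quadrant.  The value is junk if a < 0 or b < 0. *)
Definition extend_cont (R : realType) (m : R -> R -> R) (a b : R) : R :=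
  if (0 < a) && (0 < b) then m a b
  else lim ((fun z : R * R => m z.1 z.2) @
            within [set z : R * R | 0 < z.1 /\ 0 < z.2] (nbhs (a, b))).

Definition log_mean (R : realType) (t : R) : R -> R -> R :=
  extend_cont (log_mean_pos t).

Definition power_mean (R : realType) (alpha : R) : R -> R -> R :=
  extend_cont (power_mean_pos alpha).

(* Valued in the extended reals, as the integral of a nonnegative function. *)
Definition mean_divergence (R : realType) (d : measure_display)
    (T : measurableType d) (mu : {measure set T -> \bar R})
    (m : R -> R -> R) (p q : T -> R) : \bar R :=
  (\int[mu]_x (m (p x) (q x))%:E)%E.

Definition log_divergence (R : realType) (d : measure_display)
    (T : measurableType d) (mu : {measure set T -> \bar R})
    (t : R) (p q : T -> R) : \bar R :=
  mean_divergence mu (log_mean t) p q.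

Definition power_divergence (R : realType) (d : measure_display)
    (T : measurableType d) (mu : {measure set T -> \bar R})
    (alpha : R) (p q : T -> R) : \bar R :=
  mean_divergence mu (power_mean alpha) p q.

Definition exponent_bound (R : realType) (op : R -> R -> R) (r : R) : R :=
  if r <= -1 then op ((r + 2) / 3) 0
  else if r == 0 then op (2 / 3) (ln 2)
  else op ((r + 2) / 3) (r * ln 2 / ln (r + 1)).

Definition r1 (R : realType) (r : R) : R := exponent_bound Num.min r.

Definition r2 (R : realType) (r : R) : R := exponent_bound Num.max r.

(* Main.v *)
Require Import Defs.
From mathcomp Require Import all_boot all_order all_algebra.
From mathcomp Require Import all_classical all_reals all_analysis.
From mathcomp Require Import ring lra.

(* The inequality is pointwise. With a = e^(w-x) and b = e^(w+x), x > 0, the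
   means are L_r = e^(w + l(x)) and M^[alpha] = e^(w + m(x)), and the derivative
   of the gap l - m is a positive weight times a combination n of hyperbolic
   functions with n(0) = n'(0) = 0 and
   n'' - k^2 n = A sinh(u x) + B sinh(v x).
   A Sturm-type argument transfers "at most one sign change, from - to +" (and
   "no sign change") from the right-hand side to n, and then to the gap.
   - For alpha = (r+2)/3, and for alpha = 0 when r <= -1, the right-hand side has
     a constant sign, hence so has the gap.
   - For r > -1 and alpha = r ln 2 / ln(r+1) the gap vanishes at 0 and at
     infinity, which together with the single sign change fixes its sign. That
     sign depends on how alpha compares with (r+2)/3, which is read off the
     first case by letting x tend to infinity. *)

Set Implicit Arguments.
Unset Strict Implicit.
Unset Printing Implicit Defensive.

Import Order.TTheory GRing.Theory Num.Theory.
Import numFieldNormedType.Exports.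

Local Open Scope classical_set_scope.
Local Open Scope ring_scope.

(** * Differentiation rules and hyperbolic functions *)

Section Derivatives.
Context {R : realType}.
Implicit Types (f g : R -> R) (x a b u : R).

Lemma is_derive_add f g x a b : is_derive x 1 f a -> is_derive x 1 g b ->
  is_derive x 1 (fun y => f y + g y) (a + b).
Proof. exact: is_deriveD. Qed.

Lemma is_derive_sub f g x a b : is_derive x 1 f a -> is_derive x 1 g b ->
  is_derive x 1 (fun y => f y - g y) (a - b).
Proof. exact: is_deriveB. Qed.

Lemma is_derive_mul f g x a b : is_derive x 1 f a -> is_derive x 1 g b ->
  is_derive x 1 (fun y => f y * g y) (f x * b + g x * a).
Proof. exact: is_deriveM. Qed.

Lemma is_derive_scale u f x a : is_derive x 1 f a ->
  is_derive x 1 (fun y => u * f y) (u * a).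
Proof. exact: is_deriveZ. Qed.

Lemma is_derive_const x u : is_derive x 1 (fun=> u) 0.
Proof. exact: is_derive_cst. Qed.

Lemma is_derive_var x : is_derive x 1 (fun y : R => y) 1.
Proof. exact: is_derive_id. Qed.

Lemma is_derive_div f g x a b : is_derive x 1 f a ->
  is_derive x 1 g b -> g x != 0 ->
  is_derive x 1 (fun y => f y / g y) ((a * g x - f x * b) / g x ^+ 2).
Proof.
move=> fa gb gx0; have := is_deriveV gx0 gb.
move=> /(is_deriveM fa) h; apply: (is_derive_eq h).
by rewrite /GRing.scale /=; field.
Qed.

Lemma is_derive_lncomp f x a : is_derive x 1 f a -> 0 < f x ->
  is_derive x 1 (fun y => ln (f y)) (a / f x).
Proof.
move=> fa fx0; have := is_derive1_comp (is_derive1_ln fx0) fa.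
by move=> h; apply: (is_derive_eq h); rewrite mulrC.
Qed.

Lemma is_derive_continuous f x a : is_derive x 1 f a -> {for x, continuous f}.
Proof. by move=> -[/derivable1_diffP /differentiable_continuous]. Qed.

Definition sinh x := (expR x - expR (- x)) / 2.
Definition cosh x := (expR x + expR (- x)) / 2.

Lemma is_derive_expR_scale x u :
  is_derive x 1 (fun y => expR (u * y)) (u * expR (u * x)).
Proof.
have h : is_derive x 1 (fun y => u * y) u.
  by apply: (is_derive_eq (is_derive_scale u (is_derive_var x))); rewrite mulr1.
by have := is_derive1_comp (is_derive_expR (u * x)) h; rewrite mulrC.
Qed.

Lemma is_derive_sinh x u :
  is_derive x 1 (fun y => sinh (u * y)) (u * cosh (u * x)).
Proof.
rewrite (_ : (fun y => sinh (u * y)) =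
    fun y => 2^-1 * (expR (u * y) - expR (- u * y))); last first.
  by apply/funext => y; rewrite /sinh mulNr mulrC.
apply: (is_derive_eq (is_derive_scale _ (is_derive_sub
  (is_derive_expR_scale _ _) (is_derive_expR_scale _ _)))).
by rewrite /cosh !mulNr; field.
Qed.

Lemma is_derive_cosh x u :
  is_derive x 1 (fun y => cosh (u * y)) (u * sinh (u * x)).
Proof.
rewrite (_ : (fun y => cosh (u * y)) =
    fun y => 2^-1 * (expR (u * y) + expR (- u * y))); last first.
  by apply/funext => y; rewrite /cosh mulNr mulrC.
apply: (is_derive_eq (is_derive_scale _ (is_derive_add
  (is_derive_expR_scale _ _) (is_derive_expR_scale _ _)))).
by rewrite /sinh !mulNr; field.
Qed.

Lemma sinh0 : sinh 0 = 0.
Proof. by rewrite /sinh oppr0 subrr mul0r. Qed.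

Lemma cosh0 : cosh 0 = 1.
Proof. by rewrite /cosh oppr0 expR0 -[1 + 1]/2 divff. Qed.

Lemma sinhN x : sinh (- x) = - sinh x.
Proof. by rewrite /sinh opprK -mulNr opprB. Qed.

Lemma coshN x : cosh (- x) = cosh x.
Proof. by rewrite /cosh opprK addrC. Qed.

Lemma sinhD x y : sinh (x + y) = sinh x * cosh y + cosh x * sinh y.
Proof. by rewrite /sinh /cosh opprD !expRD; field. Qed.

Lemma coshD x y : cosh (x + y) = cosh x * cosh y + sinh x * sinh y.
Proof. by rewrite /sinh /cosh opprD !expRD; field. Qed.

Lemma cosh2_sinh2 x : cosh x ^+ 2 = 1 + sinh x ^+ 2.
Proof.
have E : expR x * expR (- x) = 1 by rewrite -expRD subrr expR0.
have -> : (1 : R) = expR x * expR (- x) by [].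
by rewrite /cosh /sinh; field.
Qed.

Lemma cosh_gt0 x : 0 < cosh x.
Proof. by rewrite /cosh divr_gt0// addr_gt0// expR_gt0. Qed.

Lemma sinh_gt0 x : 0 < x -> 0 < sinh x.
Proof.
by move=> x0; rewrite /sinh divr_gt0// subr_gt0 ltr_expR; lra.
Qed.

End Derivatives.

(** * Propagation of sign changes through integration and second-order equations *)

Section SingleCrossing.
Context {R : realType}.
Implicit Types (f g : R -> R) (x a b u : R).

(* On ]0, +oo[, with C = True: f changes sign at most once, and only from - to
   +; with C = False: f <= 0. *)
Definition single_crossing (C : Prop) f := forall x y,
  0 < x -> x <= y -> 0 < f x -> C /\ 0 <= f y.

(** If [f x > 0], then [f] takes a smaller value at some [a < x], so the mean value theorem gives a
    point [c < x] with [g c > 0]. From [c] on, [g] stays nonnegative, hence [f] is nondecreasing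
    after [x]. The conclusion is monotonicity rather than mere sign, so that a limit at infinity can
    be exploited later. *)
Lemma single_crossing_integral C f w g :
  (forall x e, 0 < x -> 0 < e -> exists2 y, 0 < y < x & f y < e) ->
  (forall x, 0 < x -> is_derive x 1 f (w x * g x)) ->
  (forall x, 0 < x -> 0 < w x) ->
  single_crossing C g -> forall x y, 0 < x -> x <= y -> 0 < f x ->
  C /\ f x <= f y.
Proof.
move=> f0 fg w0 Cg x y x0 xy fx0.
have cf z : 0 < z -> {for z, continuous f}.
  by move=> /fg; exact: is_derive_continuous.
have mvt a b : 0 < a -> a < b ->
    exists2 c, a < c < b & f b - f a = w c * g c * (b - a).
  move=> a0 ab.
  have [z|z|c] := @MVT R f (fun z => w z * g z) a b ab.
  - by rewrite in_itv/= => /andP[az _]; apply: fg; exact: lt_trans az.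
  - apply: continuous_in_subspaceT => {}z; rewrite inE/= in_itv/= => /andP[az _].
    by apply: cf; exact: lt_le_trans az.
  - by rewrite in_itv /=; exists c.
have [a /andP[a0 ax] fax] := f0 x _ x0 fx0.
have [c /andP[ac cx] fc] := mvt _ _ a0 ax.
have c0 : 0 < c by exact: lt_trans ac.
have gc : 0 < g c.
  have : 0 < w c * g c * (x - a) by rewrite -fc subr_gt0.
  by rewrite pmulr_lgt0 ?subr_gt0// pmulr_rgt0// w0.
split; first by case: (Cg c c c0 (lexx _) gc).
move: xy; rewrite le_eqVlt => /predU1P[->//|xy].
have [d /andP[xd dy] fd] := mvt _ _ x0 xy.
rewrite -subr_ge0 fd mulr_ge0 ?subr_ge0 ?(ltW xy)// mulr_ge0//.
  by rewrite ltW// w0// (lt_trans x0).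
by have [] := Cg c d c0 (ltW (lt_trans cx xd)) gc.
Qed.

(** Continuity at 0 together with [f 0 <= 0] provides the small values of [f] near 0 that the
    integral form asks for. *)
Lemma single_crossing_primitive C f w g :
  (forall x, is_derive x 1 f (w x * g x)) -> (forall x, 0 < w x) ->
  f 0 <= 0 -> single_crossing C g -> single_crossing C f.
Proof.
move=> fg w0 f0 Cg x y x0 xy fx0.
have [z e z0 e0|c fxy] := single_crossing_integral _
    (fun z _ => fg z) (fun z _ => w0 z) Cg x0 xy fx0.
- have /cvgrPdist_lt/(_ _ e0) := is_derive_continuous (fg 0).
  move=> /nbhs_ballP[d /= d0 hd]; exists (Num.min (z / 2) (d / 2)).
    by rewrite lt_min !divr_gt0//= gt_min; apply/orP; left; lra.
  set m := Num.min _ _; have m0 : 0 < m by rewrite lt_min !divr_gt0.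
  have : ball 0 d m.
    rewrite /ball/= sub0r normrN gtr0_norm// gt_min.
    by apply/orP; right; move: d0 => /=; lra.
  by move=> /hd; rewrite ltr_norml => /andP[+ _]; lra.
- by split=> //; exact: le_trans (ltW fx0) fxy.
Qed.

(* Writing [h = f' cosh - k f sinh], one has [h' = g cosh] and
   [(f / cosh)' = h / cosh^2]. *)
Lemma single_crossing_ode C f f' g k :
  (forall x, is_derive x 1 f (f' x)) ->
  (forall x, is_derive x 1 f' (k ^+ 2 * f x + g x)) ->
  f 0 = 0 -> f' 0 <= 0 -> single_crossing C g -> single_crossing C f.
Proof.
move=> df df' f0 f'0 Cg.
pose h x := f' x * cosh (k * x) - f x * (k * sinh (k * x)).
have Ch : single_crossing C h.
  apply: (@single_crossing_primitive _ _ (fun x => cosh (k * x)) g) => //.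
  - move=> x; apply: (is_derive_eq (is_derive_sub
      (is_derive_mul (df' x) (is_derive_cosh x k))
      (is_derive_mul (df x) (is_derive_scale k (is_derive_sinh x k))))).
    ring.
  - by move=> x; exact: cosh_gt0.
  - by rewrite /h mulr0 sinh0 cosh0 f0 mul0r subr0 mulr1.
pose q x := f x / cosh (k * x).
have Cq : single_crossing C q.
  apply: (@single_crossing_primitive _ _ (fun x => (cosh (k * x) ^+ 2)^-1) h) => //.
  - move=> x; have c0 : cosh (k * x) != 0 by rewrite gt_eqF// cosh_gt0.
    apply: (is_derive_eq (is_derive_div (df x) (is_derive_cosh x k) c0)).
    by rewrite mulrC /h.
  - by move=> x; rewrite invr_gt0 exprn_gt0// cosh_gt0.
  - by rewrite /q f0 mul0r.
move=> x y x0 xy fx; have [|c] := Cq x y x0 xy.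
  by rewrite divr_gt0// cosh_gt0.
by rewrite /q ler_pdivlMr ?cosh_gt0// mul0r.
Qed.

(** On the positive axis the function has the constant sign of [a * v], so it never crosses 0, and
    [a * v <= 0] excludes positive values altogether. *)
Lemma single_crossing_sinh (C : Prop) a v : (C \/ a * v <= 0) ->
  single_crossing C (fun x => a * sinh (v * x)).
Proof.
move=> Cav x y x0 xy.
have y0 : 0 < y by exact: lt_le_trans xy.
have [v0|v0|->] := ltgtP v 0; last by rewrite mul0r sinh0 mulr0 ltxx.
- have s z : 0 < z -> sinh (v * z) < 0.
    move=> z0; rewrite -[v]opprK mulNr sinhN oppr_lt0 sinh_gt0//.
    by rewrite mulr_gt0// oppr_gt0.
  rewrite nmulr_lgt0 ?s// => a0; split; last by rewrite mulr_le0 ?ltW ?s.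
  by case: Cav => //; rewrite nmulr_lle0// leNgt a0.
- have s z : 0 < z -> 0 < sinh (v * z).
    by move=> z0; rewrite sinh_gt0// mulr_gt0.
  rewrite pmulr_lgt0 ?s// => a0; split; last by rewrite mulr_ge0 ?ltW ?s.
  by case: Cav => //; rewrite pmulr_lle0// leNgt a0.
Qed.

(* The sum f satisfies [f'' - u^2 f = b (v^2 - u^2) sinh(v x)]. *)
Lemma single_crossing_sinh_sum (C : Prop) a b u v :
  a * u + b * v <= 0 -> (C \/ b * (v ^+ 2 - u ^+ 2) * v <= 0) ->
  single_crossing C (fun x => a * sinh (u * x) + b * sinh (v * x)).
Proof.
move=> auv Cv.
apply: (@single_crossing_ode _ _ 
  (fun x => a * (u * cosh (u * x)) + b * (v * cosh (v * x)))
  (fun x => b * (v ^+ 2 - u ^+ 2) * sinh (v * x)) u).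
- by move=> x; exact: is_derive_add
    (is_derive_scale _ (is_derive_sinh _ _)) (is_derive_scale _ (is_derive_sinh _ _)).
- move=> x; apply: (is_derive_eq (is_derive_add
    (is_derive_scale a (is_derive_scale u (is_derive_cosh x u)))
    (is_derive_scale b (is_derive_scale v (is_derive_cosh x v))))).
  ring.
- by rewrite !mulr0 sinh0 !mulr0 addr0.
- by rewrite !mulr0 cosh0 !mulr1.
- exact: single_crossing_sinh.
Qed.

End SingleCrossing.

(** * The logarithmic gap between the two means and its derivative *)

Section Gap.
Context {R : realType}.
Implicit Types (r alpha eps x y : R).

(* [ln (L_r(e^-x, e^x))], for x > 0 only. *)
Definition logL r x :=
  if r == -1 then ln (sinh x / x)
  else if r == 0 then x * cosh x / sinh x - 1
  else r^-1 * ln (sinh ((r + 1) * x) / ((r + 1) * sinh x)).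

(* [ln (M^[alpha](e^-x, e^x))]; for alpha = 0 the convention 0^-1 = 0 gives the
   correct value 0. *)
Definition logM alpha x := alpha^-1 * ln (cosh (alpha * x)).

Lemma is_derive_sinh1 x : is_derive x 1 sinh (cosh x).
Proof.
have := is_derive_sinh x 1; rewrite !mul1r (_ : (fun y => _) = sinh)//.
by apply/funext => y; rewrite mul1r.
Qed.

Lemma is_derive_cosh1 x : is_derive x 1 cosh (sinh x).
Proof.
have := is_derive_cosh x 1; rewrite !mul1r (_ : (fun y => _) = cosh)//.
by apply/funext => y; rewrite mul1r.
Qed.

(** Oddness of [sinh] makes the quotient even in [s]; this is what lets [s = r + 1] be negative. *)
Lemma sinhM_div_gt0 s x : s != 0 -> 0 < x -> 0 < sinh (s * x) / s.
Proof.
move=> s0 x0; have [s_lt|s_gt|s_eq] := ltgtP s 0.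
- rewrite -[s]opprK mulNr sinhN invrN mulrNN divr_gt0 ?oppr_gt0//.
  by rewrite sinh_gt0// mulr_gt0// oppr_gt0.
- by rewrite divr_gt0// sinh_gt0// mulr_gt0.
- by rewrite s_eq eqxx in s0.
Qed.

Lemma is_derive_logM alpha x :
  is_derive x 1 (logM alpha) (sinh (alpha * x) / cosh (alpha * x)).
Proof.
apply: (is_derive_eq (is_derive_scale _
  (is_derive_lncomp (is_derive_cosh x alpha) (cosh_gt0 _)))).
have [->|a0] := eqVneq alpha 0; first by rewrite invr0 !mul0r sinh0 mul0r.
by rewrite -mulrA mulKf.
Qed.


(** The quotient is the difference quotient at 0 of [sinh (u * x)], whose derivative there is
    [u]. *)
Lemma sinhM_div_cvg u : sinh (u * x) / x @[x --> (0 : R)^'+] --> u.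
Proof.
have [dsinh] := is_derive_sinh 0 u.
rewrite mulr0 cosh0 mulr1 => Du.
have : h^-1 *: (sinh (u * (h *: 1 + 0)) - sinh (u * 0)) @[h --> (0 : R)^'] --> u.
  by rewrite -[X in _ --> X]Du.
move=> /cvg_dnbhs_at_right; rewrite (_ : (fun h => _) = (fun x => sinh (u * x) / x))//.
apply/funext => h; rewrite mulr0 sinh0 subr0 addr0.
by rewrite /GRing.scale/= mulr1 mulrC.
Qed.

Lemma sinh_div_cvg : sinh x / x @[x --> (0 : R)^'+] --> (1:R).
Proof.
have := @sinhM_div_cvg 1; rewrite (_ : (fun x => _) = (fun x => sinh x / x))//.
by apply/funext => x; rewrite mul1r.
Qed.

Lemma ln_cvg0 (f : R -> R) (F : set_system R) : Filter F ->
  f x @[x --> F] --> (1 : R) -> ln (f x) @[x --> F] --> (0 : R).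
Proof.
move=> FF f1; rewrite -(@ln1 R); apply: continuous_cvg => //.
exact: continuous_ln.
Qed.

(** The formulas for [logL] are meaningful only for [x > 0], so the vanishing of the gap at the
    diagonal is expressed as a right limit. *)
Lemma logL_cvg0 r : logL r x @[x --> (0 : R)^'+] --> (0 : R).
Proof.
rewrite /logL; have [_|r1] /= := eqVneq.
  by apply: ln_cvg0; exact: sinh_div_cvg.
have [_|r0] /= := eqVneq.
  rewrite -[X in _ --> X](subrr 1); apply: cvgB; last exact: cvg_cst.
  rewrite (_ : (fun x => _) = (fun x => cosh x * (sinh x / x)^-1)); last first.
    by apply/funext => x; rewrite (invf_div (sinh x)); ring.
  rewrite -[X in _ --> X]mulr1 -{2}invr1; apply: cvgM; last first.
    by apply: cvgV; [exact: oner_neq0|exact: sinh_div_cvg].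
  rewrite -cosh0; apply: cvg_at_right_filter.
  exact: is_derive_continuous (is_derive_cosh1 0).
have s0 : r + 1 != 0 by rewrite -[1]opprK subr_eq0.
rewrite -[X in _ --> X](mulr0 r^-1); apply: cvgM; first exact: cvg_cst.
apply: ln_cvg0.
have : sinh ((r + 1) * x) / x * ((r + 1) * (sinh x / x))^-1
    @[x --> (0 : R)^'+] --> (1 : R).
  rewrite -[X in _ --> X](divff s0); apply: cvgM; first exact: sinhM_div_cvg.
  apply: cvgV => //; rewrite -[X in _ --> X]mulr1.
  by apply: cvgM; [exact: cvg_cst|exact: sinh_div_cvg].
apply: cvg_trans; apply: near_eq_cvg; near=> x.
have x0 : 0 < x by near: x; exact: nbhs_right_gt.
have := sinh_gt0 x0; move=> /gt_eqF/negbT p0.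
by field; rewrite s0 p0 gt_eqF.
Unshelve. all: by end_near. Qed.

Lemma logM_cvg0 alpha : logM alpha x @[x --> (0 : R)^'+] --> (0 : R).
Proof.
have E : logM alpha 0 = 0 by rewrite /logM mulr0 cosh0 ln1 mulr0.
rewrite -[X in _ --> X]E; apply: cvg_at_right_filter.
exact: is_derive_continuous (is_derive_logM alpha 0).
Qed.

(** Shared by the three forms of [logL]. The scalar [eps] serves to treat both directions of the
    inequality at once: it is later taken to be 1 or -1. *)
Lemma gap_single_crossing_of (C : Prop) r alpha eps (w n : R -> R) :
  (forall x, 0 < x ->
    is_derive x 1 (fun x => logL r x - logM alpha x) (w x * n x)) ->
  (forall x, 0 < x -> 0 < w x) -> single_crossing C (fun x => eps * n x) ->
  forall x y, 0 < x -> x <= y -> 0 < eps * (logL r x - logM alpha x) ->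
  C /\ eps * (logL r x - logM alpha x) <= eps * (logL r y - logM alpha y).
Proof.
move=> dg w0 Cn; apply: (@single_crossing_integral _ _ _ w) Cn => //.
- move=> x e x0 e0.
  have : eps * (logL r y - logM alpha y) @[y --> (0 : R)^'+] --> 0.
    rewrite -[X in _ --> X](mulr0 eps) -{2}(subrr 0).
    apply: cvgM; first exact: cvg_cst.
    by apply: cvgB; [exact: logL_cvg0|exact: logM_cvg0].
  move=> /cvgrPdist_lt/(_ _ e0) h.
  near (0 : R)^'+ => y; exists y.
    by apply/andP; split; near: y; [exact: nbhs_right_gt|exact: nbhs_right_lt].
  have : `|0 - eps * (logL r y - logM alpha y)| < e by near: y; exact: h.
  by rewrite ltr_norml => /andP[+ _]; lra.
- move=> x x0; apply: (is_derive_eq (is_derive_scale eps (dg x x0))); ring.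
Unshelve. all: by end_near. Qed.

(** * The gap for r different from 0 and -1 *)

Section Generic.
Variables r alpha : R.
Hypotheses (r0 : r != 0) (r1 : r + 1 != 0).

(** Numerator of the derivative of the gap, with products of hyperbolic functions turned into sums.
    The factor of unknown sign stays in [n], so that the weight [w] is positive. *)
Let n x := (r * (r + 1))^-1 * (r * sinh ((r + 2 - alpha) * x)
  - sinh ((r + alpha) * x) - (r + 1) * sinh ((r - alpha) * x)).

Let w x := (2 * (sinh ((r + 1) * x) / (r + 1)) * sinh x * cosh (alpha * x))^-1.

Let w_gt0 x : 0 < x -> 0 < w x.
Proof.
move=> x0; rewrite invr_gt0 mulr_gt0 ?cosh_gt0// mulr_gt0 ?sinh_gt0//.
by rewrite mulr_gt0// sinhM_div_gt0.
Qed.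

Let is_derive_gap x : 0 < x ->
  is_derive x 1 (fun x => logL r x - logM alpha x) (w x * n x).
Proof.
move=> x0; rewrite /logL -[r == -1]subr_eq0 opprK (negbTE r1) (negbTE r0).
have p0 : 0 < sinh x by exact: sinh_gt0.
have q0 := cosh_gt0 (alpha * x).
have s0 : 0 < sinh ((r + 1) * x) / (r + 1) by exact: sinhM_div_gt0.
have d0 : (r + 1) * sinh x != 0 by rewrite mulf_neq0// gt_eqF.
have h0 : 0 < sinh ((r + 1) * x) / ((r + 1) * sinh x).
  by rewrite invfM mulrA divr_gt0.
apply: (is_derive_eq (is_derive_sub (is_derive_scale r^-1
  (is_derive_lncomp (is_derive_div (is_derive_sinh x (r + 1))
    (is_derive_scale (r + 1) (is_derive_sinh1 x)) d0) h0))
  (is_derive_logM alpha x))).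
rewrite /w /n.
(* Splitting every argument into [(r + 1) * x], [x] and [alpha * x] lets the addition formulas
   reduce the claim to a rational identity in six variables. *)
have -> : (r + 2 - alpha) * x = (r + 1) * x + (x - alpha * x) by ring.
have -> : (r + alpha) * x = (r + 1) * x - (x - alpha * x) by ring.
have -> : (r - alpha) * x = (r + 1) * x - (x + alpha * x) by ring.
have S0 : sinh ((r + 1) * x) != 0.
  by apply: contraTneq s0 => ->; rewrite mul0r ltxx.
rewrite !(sinhD, coshD, sinhN, coshN).
move: p0 q0 S0 => /gt_eqF/negbT p0 /gt_eqF/negbT q0.
move: (sinh ((r + 1) * x)) (cosh ((r + 1) * x)) (sinh x) (cosh x) p0
  (sinh (alpha * x)) (cosh (alpha * x)) q0 => S S' p p' p0 a a' a0 S0.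
by field; rewrite S0 r0 p0 a0 r1.
Qed.

(** The choice [k = r - alpha] in the differential equation cancels the third term of [n], leaving a
    combination of two hyperbolic sines. *)
Let single_crossing_n (C : Prop) eps : eps * (r + 2 - 3 * alpha) <= 0 ->
  C \/ 0 <= eps * (alpha * (r + alpha) * (alpha - 1)) ->
  single_crossing C (fun x => eps * n x).
Proof.
move=> h1 h2.
apply: (@single_crossing_ode _ _ _ (fun x => eps * ((r * (r + 1))^-1 *
  (r * ((r + 2 - alpha) * cosh ((r + 2 - alpha) * x))
   - (r + alpha) * cosh ((r + alpha) * x)
   - (r + 1) * ((r - alpha) * cosh ((r - alpha) * x)))))
  (fun x => 4 * eps * (r + 1 - alpha) / (r + 1) * sinh ((r + 2 - alpha) * x)
     + - (4 * eps * alpha / (r + 1)) * sinh ((r + alpha) * x)) (r - alpha)).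
- move=> x; exact: (is_derive_scale eps (is_derive_scale _
    (is_derive_sub (is_derive_sub
      (is_derive_scale r (is_derive_sinh x (r + 2 - alpha)))
      (is_derive_sinh x (r + alpha)))
      (is_derive_scale (r + 1) (is_derive_sinh x (r - alpha)))))).
- move=> x; apply: (is_derive_eq (is_derive_scale eps (is_derive_scale _
    (is_derive_sub (is_derive_sub
      (is_derive_scale r (is_derive_scale _ (is_derive_cosh x (r + 2 - alpha))))
      (is_derive_scale _ (is_derive_cosh x (r + alpha))))
      (is_derive_scale (r + 1) (is_derive_scale _
        (is_derive_cosh x (r - alpha)))))))).
  by rewrite /n; field; rewrite r1 r0.
- by rewrite /n !mulr0 sinh0 !mulr0 !subr0 !mulr0.
- rewrite !mulr0 cosh0 !mulr1 [leLHS](_ : _ = 0)//; ring.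
(* The slope at 0 of this combination is 4 eps (r + 2 - 3 alpha), and the second quantity to be
   signed is -16 eps alpha (r + alpha) (alpha - 1). *)
- apply: single_crossing_sinh_sum.
    rewrite [leLHS](_ : _ = 4 * (eps * (r + 2 - 3 * alpha))); last by field.
    lra.
  case: h2 => [|h2]; [by left|right].
  rewrite [leLHS](_ : _ = - 16 * (eps * (alpha * (r + alpha) * (alpha - 1)))).
    lra.
  by field.
Qed.

Lemma gap_single_crossing_generic (C : Prop) eps :
  eps * (r + 2 - 3 * alpha) <= 0 ->
  C \/ 0 <= eps * (alpha * (r + alpha) * (alpha - 1)) ->
  forall x y, 0 < x -> x <= y -> 0 < eps * (logL r x - logM alpha x) ->
  C /\ eps * (logL r x - logM alpha x) <= eps * (logL r y - logM alpha y).
Proof.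
move=> h1 h2; exact: gap_single_crossing_of is_derive_gap w_gt0
  (single_crossing_n h1 h2).
Qed.

End Generic.

(** * The gap for r = 0 *)

Section ExponentZero.
Variable alpha : R.

Let n x := sinh ((2 - alpha) * x) + sinh (alpha * x)
  - 2 * (x * cosh (alpha * x)).

Let w x := (2 * sinh x ^+ 2 * cosh (alpha * x))^-1.

Let w_gt0 x : 0 < x -> 0 < w x.
Proof.
move=> x0; rewrite invr_gt0 mulr_gt0 ?cosh_gt0// mulr_gt0//.
by rewrite exprn_gt0// sinh_gt0.
Qed.

Let is_derive_gap x : 0 < x ->
  is_derive x 1 (fun x => logL 0 x - logM alpha x) (w x * n x).
Proof.
move=> x0; rewrite /logL eqxx eq_sym oppr_eq0 oner_eq0.
have p0 : sinh x != 0 by rewrite gt_eqF// sinh_gt0.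
have q0 : cosh (alpha * x) != 0 by rewrite gt_eqF// cosh_gt0.
apply: (is_derive_eq (is_derive_sub (is_derive_sub (is_derive_div
  (is_derive_mul (is_derive_var x) (is_derive_cosh1 x))
  (is_derive_sinh1 x) p0) (is_derive_const x 1)) (is_derive_logM alpha x))).
rewrite /w /n.
have -> : (2 - alpha) * x = x + (x - alpha * x) by ring.
(* The derivative of x cosh x / sinh x produces squares of [cosh x]; the identity holds only modulo
   [E]. *)
have E := cosh2_sinh2 x.
rewrite !(sinhD, coshD, sinhN, coshN).
move: (sinh x) (cosh x) (sinh (alpha * x)) (cosh (alpha * x)) E p0 q0.
move=> p p' a a' E p0 q0.
by field: E; rewrite p0 q0.
Qed.

(** With [k = alpha], the resonant term x cosh(alpha x) contributes only 2 alpha sinh(alpha x) to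
    the right-hand side. *)
Let single_crossing_n (C : Prop) eps : eps * (2 - 3 * alpha) <= 0 ->
  C \/ 0 <= eps * (alpha * alpha * (alpha - 1)) ->
  single_crossing C (fun x => eps * n x).
Proof.
move=> h1 h2.
apply: (@single_crossing_ode _ _ _ (fun x => eps *
  ((2 - alpha) * cosh ((2 - alpha) * x) + alpha * cosh (alpha * x)
   - 2 * (x * (alpha * sinh (alpha * x)) + cosh (alpha * x) * 1)))
  (fun x => 4 * eps * (1 - alpha) * sinh ((2 - alpha) * x)
     + - (4 * eps * alpha) * sinh (alpha * x)) alpha).
- move=> x; exact: (is_derive_scale eps (is_derive_sub (is_derive_add
    (is_derive_sinh x (2 - alpha)) (is_derive_sinh x alpha))
    (is_derive_scale 2
      (is_derive_mul (is_derive_var x) (is_derive_cosh x alpha))))).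
- move=> x; apply: (is_derive_eq (is_derive_scale eps (is_derive_sub
    (is_derive_add (is_derive_scale _ (is_derive_cosh x (2 - alpha)))
      (is_derive_scale _ (is_derive_cosh x alpha)))
    (is_derive_scale 2 (is_derive_add (is_derive_mul (is_derive_var x)
      (is_derive_scale _ (is_derive_sinh x alpha)))
      (is_derive_mul (is_derive_cosh x alpha) (is_derive_const x 1))))))).
  by rewrite /n; ring.
- by rewrite /n !mulr0 sinh0 mul0r mulr0 addr0 subr0 mulr0.
- rewrite !mulr0 sinh0 cosh0 !mulr1 [leLHS](_ : _ = 0)//; ring.
- apply: single_crossing_sinh_sum.
    rewrite [leLHS](_ : _ = 4 * (eps * (2 - 3 * alpha))); last by ring.
    lra.
  case: h2 => [|h2]; [by left|right].
  rewrite [leLHS](_ : _ = - 16 * (eps * (alpha * alpha * (alpha - 1)))).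
    lra.
  by ring.
Qed.

Lemma gap_single_crossing_0 (C : Prop) eps :
  eps * (2 - 3 * alpha) <= 0 ->
  C \/ 0 <= eps * (alpha * alpha * (alpha - 1)) ->
  forall x y, 0 < x -> x <= y -> 0 < eps * (logL 0 x - logM alpha x) ->
  C /\ eps * (logL 0 x - logM alpha x) <= eps * (logL 0 y - logM alpha y).
Proof.
move=> h1 h2; exact: gap_single_crossing_of is_derive_gap w_gt0
  (single_crossing_n h1 h2).
Qed.

End ExponentZero.

(** * The gap for r = -1 *)

Section ExponentNeg1.
Variable alpha : R.

Let n x := 2 * (x * cosh ((1 - alpha) * x)) - sinh ((1 + alpha) * x)
  - sinh ((1 - alpha) * x).

Let w x := (2 * x * sinh x * cosh (alpha * x))^-1.

Let w_gt0 x : 0 < x -> 0 < w x.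
Proof.
move=> x0; rewrite invr_gt0 mulr_gt0 ?cosh_gt0// mulr_gt0 ?sinh_gt0//.
by rewrite mulr_gt0.
Qed.

Let is_derive_gap x : 0 < x ->
  is_derive x 1 (fun x => logL (-1) x - logM alpha x) (w x * n x).
Proof.
move=> x0; rewrite /logL eqxx.
have q0 : cosh (alpha * x) != 0 by rewrite gt_eqF// cosh_gt0.
have xn0 : x != 0 by rewrite gt_eqF.
have h0 : 0 < sinh x / x by rewrite divr_gt0// sinh_gt0.
apply: (is_derive_eq (is_derive_sub (is_derive_lncomp (is_derive_div
  (is_derive_sinh1 x) (is_derive_var x) xn0) h0) (is_derive_logM alpha x))).
rewrite /w /n.
have -> : (1 - alpha) * x = x - alpha * x by ring.
have -> : (1 + alpha) * x = x + alpha * x by ring.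
have p0 : sinh x != 0 by rewrite gt_eqF// sinh_gt0.
rewrite !(sinhD, coshD, sinhN, coshN).
by field; rewrite p0 q0 xn0.
Qed.

(** Here the resonant term is x cosh((1 - alpha) x), hence [k = 1 - alpha]. *)
Let single_crossing_n (C : Prop) eps : eps * (1 - 3 * alpha) <= 0 ->
  C \/ 0 <= eps * (alpha * (alpha - 1) ^+ 2) ->
  single_crossing C (fun x => eps * n x).
Proof.
move=> h1 h2.
apply: (@single_crossing_ode _ _ _ (fun x => eps *
  (2 * (x * ((1 - alpha) * sinh ((1 - alpha) * x)) + cosh ((1 - alpha) * x) * 1)
   - (1 + alpha) * cosh ((1 + alpha) * x)
   - (1 - alpha) * cosh ((1 - alpha) * x)))
  (fun x => - (4 * eps * alpha) * sinh ((1 + alpha) * x) +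
     4 * eps * (1 - alpha) * sinh ((1 - alpha) * x)) (1 - alpha)).
- move=> x; exact: (is_derive_scale eps (is_derive_sub (is_derive_sub
    (is_derive_scale 2
      (is_derive_mul (is_derive_var x) (is_derive_cosh x (1 - alpha))))
    (is_derive_sinh x (1 + alpha))) (is_derive_sinh x (1 - alpha)))).
- move=> x; apply: (is_derive_eq (is_derive_scale eps (is_derive_sub
    (is_derive_sub
    (is_derive_scale 2 (is_derive_add (is_derive_mul (is_derive_var x)
      (is_derive_scale _ (is_derive_sinh x (1 - alpha))))
      (is_derive_mul (is_derive_cosh x (1 - alpha)) (is_derive_const x 1))))
    (is_derive_scale _ (is_derive_cosh x (1 + alpha))))
    (is_derive_scale _ (is_derive_cosh x (1 - alpha)))))).
  by rewrite /n; ring.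
- by rewrite /n !mulr0 sinh0 mul0r mulr0 !subr0 mulr0.
- rewrite !mulr0 sinh0 cosh0 !mulr1 [leLHS](_ : _ = 0)//; ring.
- apply: single_crossing_sinh_sum.
    rewrite [leLHS](_ : _ = 4 * (eps * (1 - 3 * alpha))); last by ring.
    lra.
  case: h2 => [|h2]; [by left|right].
  rewrite [leLHS](_ : _ = - 16 * (eps * (alpha * (alpha - 1) ^+ 2))).
    lra.
  by ring.
Qed.

Lemma gap_single_crossing_N1 (C : Prop) eps :
  eps * (1 - 3 * alpha) <= 0 ->
  C \/ 0 <= eps * (alpha * (alpha - 1) ^+ 2) ->
  forall x y, 0 < x -> x <= y -> 0 < eps * (logL (-1) x - logM alpha x) ->
  C /\ eps * (logL (-1) x - logM alpha x) <=
       eps * (logL (-1) y - logM alpha y).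
Proof.
move=> h1 h2; exact: gap_single_crossing_of is_derive_gap w_gt0
  (single_crossing_n h1 h2).
Qed.

End ExponentNeg1.

(* The right-hand side A sinh(u x) + B sinh(v x) of the differential equation
   satisfied by n has slope at 0 of the sign of r + 2 - 3 alpha, and with C = False
   the second hypothesis makes its sign constant. *)
Lemma gap_single_crossing (C : Prop) r alpha eps :
  eps * (r + 2 - 3 * alpha) <= 0 ->
  C \/ 0 <= eps * (alpha * (r + alpha) * (alpha - 1)) ->
  forall x y, 0 < x -> x <= y -> 0 < eps * (logL r x - logM alpha x) ->
  C /\ eps * (logL r x - logM alpha x) <= eps * (logL r y - logM alpha y).
Proof.
have [->|r0] := eqVneq r 0.
  by rewrite !add0r; exact: gap_single_crossing_0.
have [->|r1] := eqVneq r (-1); last first.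
  by apply: gap_single_crossing_generic => //; rewrite -[1]opprK subr_eq0.
move=> h1 h2; apply: gap_single_crossing_N1.
  by rewrite [leLHS](_ : _ = eps * (-1 + 2 - 3 * alpha))//; ring.
case: h2 => [|h2]; [by left|right].
by rewrite [leRHS](_ : _ = eps * (alpha * (-1 + alpha) * (alpha - 1)))//; ring.
Qed.

End Gap.

(** * The means on the open quadrant in logarithmic coordinates *)

Section Means.
Context {R : realType}.
Implicit Types (r alpha a b c t w x y : R).

Lemma log_mean_posC r a b : log_mean_pos r a b = log_mean_pos r b a.
Proof.
rewrite /log_mean_pos eq_sym; case: eqVneq => [->//|ab].
case: ifPn => _; first by rewrite -opprB -[ln b - _]opprB invrN mulrNN.
case: ifPn => _; last first.
  by rewrite -opprB -[b - a]opprB mulrN invrN mulrNN.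
have -> : b `^ b / a `^ a = (a `^ a / b `^ b)^-1 by rewrite invf_div.
have u0 : 0 <= a `^ a / b `^ b by rewrite divr_ge0// powR_ge0.
by rewrite -(powR_inv1 u0) -powRrM mulN1r -invrN opprB.
Qed.

Lemma power_mean_posC alpha a b :
  power_mean_pos alpha a b = power_mean_pos alpha b a.
Proof. by rewrite /power_mean_pos mulrC addrC. Qed.

Lemma expR_powR a b : expR a `^ b = expR (a * b).
Proof. by rewrite expRM. Qed.

(** For [r != 0], the powers in the formula enter through differences e^(s(w+x)) - e^(s(w-x)) = 2
    e^(sw) sinh(sx), from which the dependence on [w] factors out. For [r = 0] the exponents are
    computed directly. *)
Lemma log_mean_pos_expR r w x : 0 < x ->
  log_mean_pos r (expR (w - x)) (expR (w + x)) = expR (w + logL r x).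
Proof.
move=> x0; rewrite /log_mean_pos (inj_eq (@expR_inj R)).
have -> : (w - x == w + x) = false by apply/negbTE/eqP; lra.
have p0 := sinh_gt0 x0.
have E s : expR (s * (w + x)) - expR (s * (w - x)) =
    expR (s * w) * (2 * sinh (s * x)).
  by rewrite /sinh mulrDr mulrBr !expRD; field.
have E1 : expR (w + x) - expR (w - x) = expR w * (2 * sinh x).
  by have := E 1; rewrite !mul1r.
rewrite /logL E1; have [r1|r1] := eqVneq.
  rewrite !expRK expRD lnK ?posrE ?(divr_gt0 p0 x0)//.
  rewrite (_ : w + x - (w - x) = 2 * x); last by ring.
  by field; rewrite gt_eqF.
have [r0|r0] := eqVneq r 0.
  rewrite !expR_powR -expRB expR_powR -expRN -expRD; congr expR.
  move: p0 => /gt_eqF/negbT; rewrite /sinh /cosh mulf_eq0 => /norP[p0 _].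
  have e0 : expR w != 0 by rewrite gt_eqF ?expR_gt0.
  by rewrite !expRD; field; rewrite p0 e0.
have s0 : r + 1 != 0 by rewrite -[1]opprK subr_eq0.
have h0 : 0 < sinh ((r + 1) * x) / ((r + 1) * sinh x).
  by rewrite invfM mulrA divr_gt0// sinhM_div_gt0.
rewrite !expR_powR ![_ * (r + 1)]mulrC E.
rewrite [X in X `^ _](_ : _ =
   expR (r * w + ln (sinh ((r + 1) * x) / ((r + 1) * sinh x)))).
  by rewrite expR_powR; congr expR; field.
rewrite expRD lnK// mulrDl mul1r expRD.
by field; rewrite s0 !gt_eqF// expR_gt0.
Qed.

Lemma power_mean_pos_expR alpha w x :
  power_mean_pos alpha (expR (w - x)) (expR (w + x)) = expR (w + logM alpha x).
Proof.
rewrite /power_mean_pos /logM; have [->|a0] := eqVneq.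
  rewrite invr0 mul0r addr0 -expRD.
  rewrite (_ : w - x + (w + x) = w * 2); last by ring.
  by rewrite expRM powR_mulrn ?expR_ge0// sqrtr_sqr ger0_norm// expR_ge0.
rewrite !expR_powR.
rewrite [X in X `^ _](_ : _ = expR (alpha * w + ln (cosh (alpha * x)))).
  by rewrite expR_powR; congr expR; field.
rewrite (_ : (w - x) * alpha = alpha * w - alpha * x); last by ring.
rewrite (_ : (w + x) * alpha = alpha * w + alpha * x); last by ring.
by rewrite (expRD _ (ln _)) lnK ?posrE ?cosh_gt0// /cosh !expRD; field.
Qed.

(** Here e^w is the geometric mean of [a] and [b], and [x] is half the logarithm of b / a. *)
Lemma pos_expR_mid a b : 0 < a -> 0 < b ->
  exists w x, [/\ (0 < x) = (a < b), a = expR (w - x) & b = expR (w + x)].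
Proof.
move=> a0 b0; exists ((ln a + ln b) / 2), ((ln b - ln a) / 2); split.
- by rewrite -ltr_ln// pmulr_lgt0 ?subr_gt0// invr_gt0.
- by rewrite [X in expR X](_ : _ = ln a) ?lnK//; field.
- by rewrite [X in expR X](_ : _ = ln b) ?lnK//; field.
Qed.

Lemma log_mean_posxx r a : log_mean_pos r a a = a.
Proof. by rewrite /log_mean_pos eqxx. Qed.

Lemma power_mean_posxx alpha a : 0 < a -> power_mean_pos alpha a a = a.
Proof.
move=> a0; have := power_mean_pos_expR alpha (ln a) 0.
by rewrite subr0 addr0 lnK// /logM mulr0 cosh0 ln1 mulr0 addr0 lnK.
Qed.

(** By symmetry one may take [a < b], the diagonal being an equality; the common factor e^w then
    drops out. *)
Lemma log_mean_pos_le_power r alpha :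
  (forall x, 0 < x -> logL r x <= logM alpha x) ->
  forall a b, 0 < a -> 0 < b -> log_mean_pos r a b <= power_mean_pos alpha a b.
Proof.
move=> LM a b; wlog ab : a b / a < b => [h a0 b0|a0 b0].
  have [ab|ba|->] := ltgtP a b; first exact: h.
  - by rewrite log_mean_posC power_mean_posC h.
  - by rewrite log_mean_posxx power_mean_posxx.
have [w [x [x0 -> ->]]] := pos_expR_mid a0 b0; rewrite ab in x0.
by rewrite log_mean_pos_expR// power_mean_pos_expR ler_expR lerD2l LM.
Qed.

Lemma power_le_log_mean_pos r alpha :
  (forall x, 0 < x -> logM alpha x <= logL r x) ->
  forall a b, 0 < a -> 0 < b -> power_mean_pos alpha a b <= log_mean_pos r a b.
Proof.
move=> LM a b; wlog ab : a b / a < b => [h a0 b0|a0 b0].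
  have [ab|ba|->] := ltgtP a b; first exact: h.
  - by rewrite log_mean_posC power_mean_posC h.
  - by rewrite log_mean_posxx power_mean_posxx.
have [w [x [x0 -> ->]]] := pos_expR_mid a0 b0; rewrite ab in x0.
by rewrite log_mean_pos_expR// power_mean_pos_expR ler_expR lerD2l LM.
Qed.

End Means.

(** * Extension of homogeneous means to the closed quadrant *)

Section BoundaryExtension.
Context {R : realType}.
Implicit Types (m : R -> R -> R) (a b c k t : R).

Local Notation quadrant_at a b :=
  (within [set z : R * R | 0 < z.1 /\ 0 < z.2] (nbhs (a, b))).

Lemma quadrant_at_proper a b : 0 <= a -> 0 <= b ->
  ProperFilter (quadrant_at a b).
Proof.
move=> a0 b0; apply: Build_ProperFilter.
rewrite /within /= => /nbhs_ballP[e /= e0 eP].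
(* A diagonal shift stays within distance [e] and enters the open quadrant, whichever coordinates
   vanish. *)
apply: (eP (a + e / 2, b + e / 2)); last by rewrite /=; split; lra.
by split; rewrite /ball /= opprD addNKr normrN gtr0_norm ?divr_gt0//; lra.
Qed.

(** Since [lim] has a default value where no limit exists, this condition is what makes
    [extend_cont m] a genuine limit on the boundary. *)
Definition boundary_cvg m := forall a b, 0 <= a -> 0 <= b ->
  ~~ ((0 < a) && (0 < b)) ->
  cvg (m z.1 z.2 @[z --> quadrant_at a b]).

Lemma quadrant_near a b :
  \forall z \near quadrant_at a b, 0 < z.1 /\ 0 < z.2.
Proof. exact: withinT. Qed.

Lemma extend_cont_le m1 m2 :
  (forall a b, 0 < a -> 0 < b -> m1 a b <= m2 a b) ->
  boundary_cvg m1 -> boundary_cvg m2 ->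
  forall a b, 0 <= a -> 0 <= b -> extend_cont m1 a b <= extend_cont m2 a b.
Proof.
move=> m12 c1 c2 a b a0 b0; rewrite /extend_cont.
case: ifPn => [/andP[]|ab]; first exact: m12.
have FF := quadrant_at_proper a0 b0.
apply: (@ler_lim _ (quadrant_at a b)); [exact: c1|exact: c2|].
near=> z; have [z1 z2] : 0 < z.1 /\ 0 < z.2 by near: z; exact: quadrant_near.
exact: m12.
Unshelve. all: by end_near. Qed.

Lemma extend_cont_ge0 m : (forall a b, 0 < a -> 0 < b -> 0 <= m a b) ->
  boundary_cvg m -> forall a b, 0 <= a -> 0 <= b -> 0 <= extend_cont m a b.
Proof.
move=> m0 cm a b a0 b0; rewrite /extend_cont.
case: ifPn => [/andP[]|ab]; first exact: m0.
have FF := quadrant_at_proper a0 b0.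
apply: limr_ge; first exact: cm.
near=> z; have [z1 z2] : 0 < z.1 /\ 0 < z.2 by near: z; exact: quadrant_near.
exact: m0.
Unshelve. all: by end_near. Qed.

Lemma quadrant_cvg1 a b : z.1 @[z --> quadrant_at a b] --> a.
Proof. by apply: cvg_within_filter; exact: cvg_fst. Qed.

Lemma quadrant_cvg2 a b : z.2 @[z --> quadrant_at a b] --> b.
Proof. by apply: cvg_within_filter; exact: cvg_snd. Qed.

(** Homogeneity gives m(u, v) = v m(u/v, 1), and u/v tends to 0 from the right. The functions [u]
    and [v] are abstract so that either coordinate can be the vanishing one. *)
Lemma homogeneous_cvg (T : Type) (F : set_system T) (u v : T -> R) m b c :
  Filter F -> (forall k, 0 < k -> forall a, 0 < a -> m a k = k * m (a / k) 1) ->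
  0 < b -> u z @[z --> F] --> (0 : R) -> v z @[z --> F] --> b ->
  (\forall z \near F, 0 < u z /\ 0 < v z) ->
  m t 1 @[t --> (0 : R)^'+] --> c ->
  m (u z) (v z) @[z --> F] --> b * c.
Proof.
move=> FF hm b0 u0 vb uv mc.
have q : u z / v z @[z --> F] --> (0 : R)^'+.
  have q0 : u z / v z @[z --> F] --> (0 : R).
    rewrite -[X in _ --> X](mul0r b^-1); apply: cvgM => //.
    by apply: cvgV => //; rewrite gt_eqF.
  move=> P hP; have := q0 _ hP; rewrite /nbhs /= => h.
  near=> z; have [uz vz] : 0 < u z /\ 0 < v z by near: z.
  suff : 0 < u z / v z -> P (u z / v z) by apply; rewrite divr_gt0.
  by near: z.
have : v z * m (u z / v z) 1 @[z --> F] --> b * c.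
  by apply: cvgM => //; exact: cvg_comp q mc.
apply: cvg_trans; apply: near_eq_cvg; near=> z.
have [uz vz] : 0 < u z /\ 0 < v z by near: z.
by rewrite [RHS]hm.
Unshelve. all: by end_near. Qed.

(** At the origin the bound by [a + b] squeezes [m] to 0; on the axis [a = 0] homogeneity applies,
    and symmetry carries this to the other axis. *)
Lemma homogeneous_boundary_cvg m c :
  (forall a b, m a b = m b a) ->
  (forall k, 0 < k -> forall a, 0 < a -> m a k = k * m (a / k) 1) ->
  (forall a b, 0 < a -> 0 < b -> 0 <= m a b <= a + b) ->
  m t 1 @[t --> (0 : R)^'+] --> c -> boundary_cvg m.
Proof.
move=> sm hm bm mc a b; rewrite le_eqVlt => /predU1P[<-|a0].
  rewrite le_eqVlt => /predU1P[<-|b0] _; apply/cvg_ex.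
    exists (0 : R); apply: (@squeeze_cvgr _ _ _ _ (cst 0) (fun z => z.1 + z.2)).
    - near=> z; have [z1 z2] : 0 < z.1 /\ 0 < z.2.
        by near: z; exact: quadrant_near.
      exact: bm.
    - exact: cvg_cst.
    - rewrite -[X in _ --> X](addr0 0).
      by apply: cvgD; [exact: quadrant_cvg1|exact: quadrant_cvg2].
  exists (b * c); apply: homogeneous_cvg => //.
  - exact: quadrant_cvg1.
  - exact: quadrant_cvg2.
  - exact: quadrant_near.
rewrite le_eqVlt => /predU1P[<-|b0]; last by rewrite a0 b0.
move=> _; apply/cvg_ex; exists (a * c).
under eq_fun do rewrite sm.
apply: homogeneous_cvg => //.
- exact: quadrant_cvg2.
- exact: quadrant_cvg1.
- by near=> z; apply/and_comm; near: z; exact: quadrant_near.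
Unshelve. all: by end_near. Qed.

End BoundaryExtension.

(** * Homogeneity, bounds and limits of the two means at an axis *)

Section MeansAtBoundary.
Context {R : realType}.
Implicit Types (r alpha a b c k t : R).

(** In logarithmic coordinates a scaling translates [w] and leaves [x] fixed. *)
Lemma log_mean_pos_homogeneous r k : 0 < k -> forall a, 0 < a ->
  log_mean_pos r a k = k * log_mean_pos r (a / k) 1.
Proof.
move=> k0 a a0; have e0 : 0 < a / k by rewrite divr_gt0.
have Ek : expR (ln k) = k by rewrite lnK.
have ak : k * (a / k) = a by rewrite mulrC divfK// gt_eqF.
have h x w : 0 < x -> log_mean_pos r (expR w * expR (- x)) (expR w * expR x) =
    expR w * log_mean_pos r (expR (- x)) (expR x).
  move=> x0; rewrite -!expRD log_mean_pos_expR//.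
  by have := log_mean_pos_expR r 0 x0; rewrite !add0r => ->; rewrite expRD.
have h' p q w : 0 < p -> 0 < q ->
    log_mean_pos r (expR w * p) (expR w * q) = expR w * log_mean_pos r p q.
  wlog pq : p q / p < q => [H p0 q0|p0 q0].
    have [pq|qp|->] := ltgtP p q; first exact: H.
    - by rewrite log_mean_posC H// log_mean_posC.
    - by rewrite !log_mean_posxx.
  have [v [x [x0 -> ->]]] := pos_expR_mid p0 q0; rewrite pq in x0.
  by rewrite -!expRD !addrA !log_mean_pos_expR// -expRD addrA.
have := h' (a / k) 1 (ln k) e0 ltr01.
by rewrite Ek mulr1 ak.
Qed.

Lemma power_mean_pos_homogeneous alpha k : 0 < k -> forall a, 0 < a ->
  power_mean_pos alpha a k = k * power_mean_pos alpha (a / k) 1.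
Proof.
move=> k0 a a0.
have Ek : expR (ln k) = k by rewrite lnK.
have ak : k * (a / k) = a by rewrite mulrC divfK// gt_eqF.
have h' p q w : 0 < p -> 0 < q ->
    power_mean_pos alpha (expR w * p) (expR w * q) =
    expR w * power_mean_pos alpha p q.
  move=> p0 q0; have [v [x [_ -> ->]]] := pos_expR_mid p0 q0.
  by rewrite -!expRD !addrA !power_mean_pos_expR -expRD addrA.
have := h' (a / k) 1 (ln k) (divr_gt0 a0 k0) ltr01.
by rewrite Ek mulr1 ak.
Qed.

Lemma ln_cosh_le (x : R) : 0 <= x -> 0 <= ln (cosh x) <= x.
Proof.
move=> x0; apply/andP; split.
  apply: ln_ge0; rewrite -(@ler_pXn2r _ 2) ?nnegrE ?(ltW (cosh_gt0 _))//.
  by rewrite cosh2_sinh2 expr1n lerDl sqr_ge0.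
rewrite -ler_expR lnK ?posrE ?cosh_gt0// /cosh.
have : expR (- x) <= expR x by rewrite ler_expR; lra.
lra.
Qed.

(** This says that a power mean is at most its larger argument. It follows from 1 <= cosh y <= e^y
    at y = |alpha| x; for [alpha < 0] the left-hand side is even nonpositive. *)
Lemma logM_le alpha (x : R) : 0 <= x -> logM alpha x <= x.
Proof.
move=> x0; rewrite /logM; have [a0|a0|->] := ltgtP alpha 0; last first.
- by rewrite invr0 mul0r.
- rewrite mulrC ler_pdivrMr// [x * _]mulrC.
  by have /andP[] := ln_cosh_le (mulr_ge0 (ltW a0) x0).
- apply: (le_trans _ x0); rewrite nmulr_rle0 ?invr_lt0//.
  rewrite -coshN -mulNr.
  have : 0 <= - alpha * x by rewrite mulr_ge0// oppr_ge0 ltW.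
  by move=> /ln_cosh_le/andP[].
Qed.

Lemma power_mean_pos_bound alpha a b : 0 < a -> 0 < b ->
  0 <= power_mean_pos alpha a b <= a + b.
Proof.
wlog ab : a b / a <= b => [h a0 b0|a0 b0].
  have [ab|/ltW ba] := leP a b; first exact: h.
  by rewrite power_mean_posC addrC h.
have [w [x [_ Ea Eb]]] := pos_expR_mid a0 b0.
have x0 : 0 <= x by move: ab; rewrite Ea Eb ler_expR; lra.
rewrite Ea Eb power_mean_pos_expR expR_ge0/=.
apply: (@le_trans _ _ (expR (w + x))); last by rewrite lerDr expR_ge0.
by rewrite ler_expR lerD2l logM_le.
Qed.

Lemma log_mean_pos_ge0 r a b : 0 < a -> 0 < b -> 0 <= log_mean_pos r a b.
Proof.
wlog ab : a b / a < b => [h a0 b0|a0 b0].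
  have [ab|ba|->] := ltgtP a b; first exact: h.
  - by rewrite log_mean_posC h.
  - by rewrite log_mean_posxx ltW.
have [w [x [x0 -> ->]]] := pos_expR_mid a0 b0; rewrite ab in x0.
by rewrite log_mean_pos_expR// expR_ge0.
Qed.

(** With [C = False], a single point of positive gap is already contradictory, so the crossing lemma
    is used at [y = x]. *)
Lemma logL_le_logM r alpha : r + 2 <= 3 * alpha ->
  0 <= alpha * (r + alpha) * (alpha - 1) ->
  forall x, 0 < x -> logL r x <= logM alpha x.
Proof.
move=> h1 h2 x x0; rewrite leNgt; apply/negP => lt.
have [|||[]] // := @gap_single_crossing _ False r alpha 1 _ _ x x x0 (lexx _).
- lra.
- by right; rewrite mul1r.
- by rewrite mul1r subr_gt0.
Qed.

Lemma logM_le_logL r alpha : 3 * alpha <= r + 2 ->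
  alpha * (r + alpha) * (alpha - 1) <= 0 ->
  forall x, 0 < x -> logM alpha x <= logL r x.
Proof.
move=> h1 h2 x x0; rewrite leNgt; apply/negP => lt.
have [|||[]] // := @gap_single_crossing _ False r alpha (-1) _ _ x x x0 (lexx _).
- lra.
- by right; rewrite mulN1r oppr_ge0.
- by rewrite mulN1r opprB subr_gt0.
Qed.

Lemma log_mean_pos_bound r a b : 0 < a -> 0 < b ->
  0 <= log_mean_pos r a b <= a + b.
Proof.
move=> a0 b0; rewrite log_mean_pos_ge0//=.
(* 1 + |r| is large enough for [logL_le_logM]. *)
have /andP[_] := power_mean_pos_bound (1 + `|r|) a0 b0; apply: le_trans.
have := ler_norm r; have := ler_norm (- r); rewrite normrN => r1 r2.
apply: log_mean_pos_le_power => //; apply: logL_le_logM; first lra.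
by rewrite mulr_ge0 ?mulr_ge0//; lra.
Qed.

Lemma powR_cvg (T : Type) (F : set_system T) (f : T -> R) (l p : R) : Filter F ->
  0 < l -> f z @[z --> F] --> l -> f z `^ p @[z --> F] --> l `^ p.
Proof.
move=> FF l0 fl; apply: (@continuous_cvg _ _ _ F FF f (fun x => x `^ p)) => //.
exact: is_derive_continuous (is_derive1_powR p l0).
Qed.

Lemma near0_lt1 : \forall t \near (0 : R)^'+, 0 < t /\ t < 1.
Proof.
near=> t; split; near: t; first exact: nbhs_right_gt.
exact: nbhs_right_lt.
Unshelve. all: by end_near. Qed.

Lemma id_cvg0 : t @[t --> (0 : R)^'+] --> (0 : R).
Proof. by apply: cvg_at_right_filter; exact: cvg_id. Qed.

(** The limit is 2^(-1/alpha), written as an exponential so that limits can be compared through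
    their exponents. *)
Lemma power_mean_pos_cvg_gt0 alpha : 0 < alpha ->
  power_mean_pos alpha t 1 @[t --> (0 : R)^'+] --> expR (- (ln 2 / alpha)).
Proof.
move=> a0; rewrite /power_mean_pos gt_eqF// powR1.
have -> : expR (- (ln 2 / alpha)) = ((0 + 1) / 2 : R) `^ alpha^-1.
  rewrite add0r mul1r /powR invr_eq0 pnatr_eq0 /= lnV ?posrE//.
  by congr expR; ring.
apply: powR_cvg; first by rewrite divr_gt0.
apply: cvgM; last exact: cvg_cst.
by apply: cvgD; [exact: powR_cvg0|exact: cvg_cst].
Qed.

Lemma power_mean_pos_cvg_le0 alpha : alpha <= 0 ->
  power_mean_pos alpha t 1 @[t --> (0 : R)^'+] --> (0 : R).
Proof.
rewrite le_eqVlt => /predU1P[->|a0].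
  rewrite /power_mean_pos eqxx.
  have h : t `^ 2^-1 @[t --> (0 : R)^'+] --> (0 : R) by exact: powR_cvg0.
  apply: cvg_trans h; apply: near_eq_cvg; near=> t.
  have [t0 _] : 0 < t /\ t < 1 by near: t; exact: near0_lt1.
  by rewrite mulr1 powR12_sqrt// ltW.
(* For negative [alpha] the power [t ^ alpha] blows up; pulling it out of the outer power yields the
   factor [t] and a bounded remainder. *)
have h : t * ((1 + t `^ (- alpha)) / 2) `^ alpha^-1 @[t --> (0 : R)^'+]
    --> 0 * ((1 + 0) / 2 : R) `^ alpha^-1.
  apply: cvgM; first exact: id_cvg0.
  apply: powR_cvg; first by rewrite divr_gt0// addr0.
  apply: cvgM; last exact: cvg_cst.
  by apply: cvgD; [exact: cvg_cst|apply: powR_cvg0; rewrite oppr_gt0].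
rewrite mul0r in h; apply: cvg_trans h; apply: near_eq_cvg; near=> t.
have [t0 _] : 0 < t /\ t < 1 by near: t; exact: near0_lt1.
rewrite /power_mean_pos lt_eqF// powR1.
rewrite (_ : (t `^ alpha + 1) / 2 = t `^ alpha * ((1 + t `^ (- alpha)) / 2)).
  by rewrite [RHS]powRM ?divr_ge0 ?addr_ge0 ?powR_ge0// -powRrM divff ?lt_eqF//
    powRr1 ?ltW.
rewrite powRN; field; by rewrite gt_eqF// powR_gt0.
Unshelve. all: by end_near. Qed.

Lemma log_mean_pos_cvg_gtN1 r : -1 < r -> r != 0 ->
  log_mean_pos r t 1 @[t --> (0 : R)^'+] --> (r + 1)^-1 `^ r^-1.
Proof.
move=> r1 r0; have s0 : 0 < r + 1 by lra.
have h : ((1 - t `^ (r + 1)) / ((r + 1) * (1 - t))) `^ r^-1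
    @[t --> (0 : R)^'+] --> ((1 - 0) / ((r + 1) * (1 - 0))) `^ r^-1.
  apply: powR_cvg; first by rewrite !subr0 mulr1 divr_gt0.
  apply: cvgM; first by apply: cvgB; [exact: cvg_cst|exact: powR_cvg0].
  apply: cvgV; first by rewrite subr0 mulr1 gt_eqF.
  apply: cvgM; first exact: cvg_cst.
  by apply: cvgB; [exact: cvg_cst|exact: id_cvg0].
rewrite !subr0 mulr1 mul1r in h; apply: cvg_trans h; apply: near_eq_cvg.
near=> t; have [t0 t1] : 0 < t /\ t < 1 by near: t; exact: near0_lt1.
by rewrite /log_mean_pos lt_eqF// gt_eqF// (negbTE r0) powR1.
Unshelve. all: by end_near. Qed.

Lemma xlnx_cvg0 : t * ln t @[t --> (0 : R)^'+] --> (0 : R).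
Proof.
have h : - 2 * t `^ 2^-1 @[t --> (0 : R)^'+] --> (0 : R).
  rewrite -[X in _ --> X](mulr0 (- 2)); apply: cvgM; first exact: cvg_cst.
  exact: powR_cvg0.
apply: (squeeze_cvgr _ h (cvg_cst 0)); near=> t.
have [t0 t1] : 0 < t /\ t < 1 by near: t; exact: near0_lt1.
apply/andP; split; last by rewrite pmulr_rle0// ln_le0// ltW.
(* Applying ln y < y at y = t^(-1/2) and multiplying by [t] gives the lower bound -2 t^(1/2). *)
have : ln (t `^ (- 2^-1)) < t `^ (- 2^-1).
  by apply: ln_sublinear; exact: powR_gt0.
rewrite ln_powR => /(ltW)/(ler_wpM2l (ltW t0)).
have -> : t * t `^ (- 2^-1) = t `^ 2^-1.
  rewrite -{1}(powRr1 (ltW t0)) -powRD; last by rewrite (gt_eqF t0) /= implybT.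
  by congr powR; field.
lra.
Unshelve. all: by end_near. Qed.

Lemma log_mean_pos_cvg_0 :
  log_mean_pos 0 t 1 @[t --> (0 : R)^'+] --> expR (-1 : R).
Proof.
have h : expR (- 1) * expR (- ((1 - t)^-1 * (t * ln t)))
    @[t --> (0 : R)^'+] --> expR (- 1) * expR (- ((1 - 0)^-1 * 0 : R)).
  apply: cvgM; first exact: cvg_cst.
  apply: continuous_cvg; first exact: continuous_expR.
  apply: cvgN; apply: cvgM; last exact: xlnx_cvg0.
  apply: cvgV; first by rewrite subr0 oner_neq0.
  by apply: cvgB; [exact: cvg_cst|exact: id_cvg0].
rewrite mulr0 oppr0 expR0 mulr1 in h; apply: cvg_trans h; apply: near_eq_cvg.
near=> t; have [t0 t1] : 0 < t /\ t < 1 by near: t; exact: near0_lt1.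
rewrite /log_mean_pos lt_eqF// eq_sym oppr_eq0 oner_eq0 eqxx powR1 mul1r.
rewrite -expRN; congr (_ * _).
rewrite -powRN [t `^ _]/powR gt_eqF// expR_powR; congr expR; ring.
Unshelve. all: by end_near. Qed.

Lemma log_mean_pos_cvg_N1 :
  log_mean_pos (-1) t 1 @[t --> (0 : R)^'+] --> (0 : R).
Proof.
have l : (- ln t)^-1 @[t --> (0 : R)^'+] --> (0 : R).
  apply/gtr0_cvgV0.
    near=> t; have [t0 t1] : 0 < t /\ t < 1 by near: t; exact: near0_lt1.
    by rewrite oppr_gt0 ln_lt0// t0.
  exact/cvgNry/lnNy.
have h : (1 - t) * (- ln t)^-1 @[t --> (0 : R)^'+] --> (1 - 0) * (0 : R).
  by apply: cvgM => //; apply: cvgB; [exact: cvg_cst|exact: id_cvg0].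
rewrite mulr0 in h; apply: cvg_trans h; apply: near_eq_cvg.
near=> t; have [t0 t1] : 0 < t /\ t < 1 by near: t; exact: near0_lt1.
by rewrite /log_mean_pos lt_eqF// eqxx ln1 sub0r.
Unshelve. all: by end_near. Qed.

Lemma log_mean_pos_cvg_ltN1 r : r < -1 ->
  log_mean_pos r t 1 @[t --> (0 : R)^'+] --> (0 : R).
Proof.
move=> r1; have s0 : 0 < - (r + 1) by lra.
have rs : 0 < (r + 1) / r by rewrite -mulrNN -invrN divr_gt0//; lra.
(* The dominant power t^(r+1) is pulled out of the bracket; its exponent (r + 1) / r is positive
   because both terms are negative. *)
have h : t `^ ((r + 1) / r) *
    ((1 - t `^ (- (r + 1))) / (- (r + 1) * (1 - t))) `^ r^-1
    @[t --> (0 : R)^'+] --> 0 * ((1 - 0) / (- (r + 1) * (1 - 0))) `^ r^-1.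
  apply: cvgM; first exact: powR_cvg0.
  apply: powR_cvg; first by rewrite !subr0 mulr1 divr_gt0.
  apply: cvgM; first by apply: cvgB; [exact: cvg_cst|exact: powR_cvg0].
  apply: cvgV; first by rewrite subr0 mulr1 gt_eqF.
  apply: cvgM; first exact: cvg_cst.
  by apply: cvgB; [exact: cvg_cst|exact: id_cvg0].
rewrite mul0r in h; apply: cvg_trans h; apply: near_eq_cvg.
near=> t; have [t0 t1] : 0 < t /\ t < 1 by near: t; exact: near0_lt1.
rewrite /log_mean_pos lt_eqF// lt_eqF// (lt_eqF (lt_trans r1 _))// powR1.
have q0 : 0 < t `^ (- (r + 1)) by exact: powR_gt0.
have q1 : t `^ (- (r + 1)) <= 1.
  by rewrite -[leRHS](powRr0 t); apply: ger_powR; rewrite ?t0 ?ltW.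
rewrite powRrM -powRM; [|exact: powR_ge0|]; last first.
  by rewrite divr_ge0 ?subr_ge0// mulr_ge0 ?ltW// subr_gt0.
congr (_ `^ _); rewrite powRN; field.
by rewrite subr_eq0 gt_eqF// (gt_eqF (powR_gt0 _ t0)) lt_eqF//; lra.
Unshelve. all: by end_near. Qed.

End MeansAtBoundary.

(** * Comparison of the two means with optimal power exponents *)

Section Pittenger.
Context {R : realType}.
Implicit Types (r alpha eps a b : R).

Lemma log_mean_boundary_cvg r : boundary_cvg (log_mean_pos r).
Proof.
have [c rc] : exists c : R, log_mean_pos r t 1 @[t --> (0 : R)^'+] --> c.
  have [r1|r1|->] := ltgtP r (-1).
  - by exists 0; exact: log_mean_pos_cvg_ltN1.
  - have [->|r0] := eqVneq r 0; first by exists (expR (-1)); exact: log_mean_pos_cvg_0.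
    by exists ((r + 1)^-1 `^ r^-1); exact: log_mean_pos_cvg_gtN1.
  - by exists 0; exact: log_mean_pos_cvg_N1.
apply: homogeneous_boundary_cvg rc.
- exact: log_mean_posC.
- by move=> k k0 a a0; exact: log_mean_pos_homogeneous.
- by move=> a b; exact: log_mean_pos_bound.
Qed.

Lemma power_mean_boundary_cvg alpha : boundary_cvg (power_mean_pos alpha).
Proof.
have [c rc] : exists c : R, power_mean_pos alpha t 1 @[t --> (0 : R)^'+] --> c.
  have [a0|a0] := leP alpha 0.
  - by exists 0; exact: power_mean_pos_cvg_le0.
  - by exists (expR (- (ln 2 / alpha))); exact: power_mean_pos_cvg_gt0.
apply: homogeneous_boundary_cvg rc.
- exact: power_mean_posC.
- by move=> k k0 a a0; exact: power_mean_pos_homogeneous.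
- by move=> a b; exact: power_mean_pos_bound.
Qed.

(* The exponent alpha for which L_r and M^[alpha] agree on the boundary of the
   quadrant; the value at r = 0 is the limit of the formula. *)
Definition boundary_exponent r :=
  if r == 0 then ln 2 else r * ln 2 / ln (r + 1).

(** Both [r] and [ln (r + 1)] have the same sign. *)
Lemma boundary_exponent_gt0 r : -1 < r -> 0 < boundary_exponent r.
Proof.
move=> r1; have l2 : 0 < ln (2 : R) by rewrite ln_gt0// ltr1n.
rewrite /boundary_exponent; have [//|r0] := eqVneq.
rewrite mulrAC mulr_gt0//.
have [rn|rp|re] := ltgtP r 0; last by rewrite re eqxx in r0.
- rewrite -mulrNN -invrN divr_gt0 ?oppr_gt0// ln_lt0//.
  by apply/andP; split; lra.
- by rewrite divr_gt0// ln_gt0//; lra.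
Qed.

(** The boundary exponent is the solution alpha of 2^(-1/alpha) = (r + 1)^(-1/r), with right-hand
    side 1/e when [r = 0]. *)
Lemma log_mean_pos_cvg_boundary r : -1 < r ->
  log_mean_pos r t 1 @[t --> (0 : R)^'+] -->
  expR (- (ln 2 / boundary_exponent r)).
Proof.
move=> r1; have l2 : ln (2 : R) != 0 by rewrite gt_eqF// ln_gt0// ltr1n.
rewrite /boundary_exponent; have [->|r0] := eqVneq.
  by rewrite divff//; exact: log_mean_pos_cvg_0.
have -> : expR (- (ln 2 / (r * ln 2 / ln (r + 1)))) = (r + 1)^-1 `^ r^-1.
  have s0 : 0 < r + 1 by lra.
  rewrite /powR invr_eq0 (gt_eqF s0) lnV ?posrE//; congr expR.
  by rewrite invf_div; field; rewrite l2 r0.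
exact: log_mean_pos_cvg_gtN1.
Qed.

(** The pair (t, 1) has coordinates w = (ln t) / 2 and x = -(ln t) / 2, so letting [x] go to
    infinity amounts to approaching the axis, where the two means have the same nonzero limit. *)
Lemma gap_cvg_boundary r : -1 < r ->
  logL r (- ln t / 2) - logM (boundary_exponent r) (- ln t / 2)
  @[t --> (0 : R)^'+] --> (0 : R).
Proof.
move=> r1.
have h : ln (log_mean_pos r t 1 / power_mean_pos (boundary_exponent r) t 1)
    @[t --> (0 : R)^'+] --> (0 : R).
  apply: ln_cvg0.
  set c := expR (- (ln 2 / boundary_exponent r)).
  have c0 : c != 0 by rewrite gt_eqF// expR_gt0.
  rewrite -[X in _ --> X](divff c0); apply: cvgM; first exact: log_mean_pos_cvg_boundary.
  by apply: cvgV => //; apply: power_mean_pos_cvg_gt0; exact: boundary_exponent_gt0.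
apply: cvg_trans h; apply: near_eq_cvg.
near=> t; have [t0 t1] : 0 < t /\ t < 1 by near: t; exact: near0_lt1.
have x0 : 0 < - ln t / 2 by rewrite divr_gt0// oppr_gt0 ln_lt0// t0.
have -> : log_mean_pos r t 1 = log_mean_pos r
    (expR (ln t / 2 - - ln t / 2)) (expR (ln t / 2 + - ln t / 2)).
  by congr (log_mean_pos r _ _);
    [rewrite [X in expR X](_ : _ = ln t) ?lnK//; field
    |rewrite [X in expR X](_ : _ = 0) ?expR0//; field].
have -> : power_mean_pos (boundary_exponent r) t 1 =
    power_mean_pos (boundary_exponent r)
    (expR (ln t / 2 - - ln t / 2)) (expR (ln t / 2 + - ln t / 2)).
  by congr (power_mean_pos _ _ _);
    [rewrite [X in expR X](_ : _ = ln t) ?lnK//; field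
    |rewrite [X in expR X](_ : _ = 0) ?expR0//; field].
by rewrite log_mean_pos_expR// power_mean_pos_expR -expRB expRK; ring.
Unshelve. all: by end_near. Qed.

(** A positive value of the signed gap could only grow afterwards, contradicting its limit 0 at
    infinity. *)
Lemma gap_boundary_exponent r eps : -1 < r ->
  eps * (r + 2 - 3 * boundary_exponent r) <= 0 ->
  forall x, 0 < x -> eps * (logL r x - logM (boundary_exponent r) x) <= 0.
Proof.
move=> r1 h x x0; rewrite leNgt; apply/negP => lt.
have mono y : x <= y -> eps * (logL r x - logM (boundary_exponent r) x) <=
    eps * (logL r y - logM (boundary_exponent r) y).
  by move=> xy; have [] := @gap_single_crossing _ True r
    (boundary_exponent r) eps h (or_introl I) x y x0 xy lt.
have : eps * (logL r x - logM (boundary_exponent r) x) <= eps * 0.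
  have c : eps * (logL r (- ln t / 2)
      - logM (boundary_exponent r) (- ln t / 2)) @[t --> (0 : R)^'+] --> eps * 0.
    by apply: cvgM; [exact: cvg_cst|exact: gap_cvg_boundary].
  apply: (cvgr_to_ge c); near=> t; apply: mono.
  have t0 : 0 < t by near: t; exact: nbhs_right_gt.
  (* This is the condition for the point -(ln t) / 2 to lie beyond [x]. *)
  have : t < expR (- (2 * x)).
    by near: t; apply: nbhs_right_lt; exact: expR_gt0.
  rewrite -ltr_ln ?posrE ?expR_gt0// expRK; lra.
by rewrite mulr0 leNgt lt.
Unshelve. all: by end_near. Qed.

(** Passing to the limit at (t, 1) compares 2^(-1/alpha) with the same expression at the boundary
    exponent, and this expression increases with the exponent. *)
Lemma le_boundary_exponent r alpha : -1 < r -> 0 < alpha ->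
  (forall a b, 0 < a -> 0 < b -> power_mean_pos alpha a b <= log_mean_pos r a b)
  -> alpha <= boundary_exponent r.
Proof.
move=> r1 a0 h.
have : expR (- (ln 2 / alpha)) <= expR (- (ln 2 / boundary_exponent r)).
  apply: (ler_cvg_to (power_mean_pos_cvg_gt0 a0) (log_mean_pos_cvg_boundary r1)).
  by near=> t; apply: h.
by rewrite ler_expR lerN2 ler_pM2l ?ln_gt0 ?ltr1n// lef_pV2 ?posrE//
  boundary_exponent_gt0.
Unshelve. all: by end_near. Qed.

Lemma boundary_exponent_le r alpha : -1 < r -> 0 < alpha ->
  (forall a b, 0 < a -> 0 < b -> log_mean_pos r a b <= power_mean_pos alpha a b)
  -> boundary_exponent r <= alpha.
Proof.
move=> r1 a0 h.
have : expR (- (ln 2 / boundary_exponent r)) <= expR (- (ln 2 / alpha)).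
  apply: (ler_cvg_to (log_mean_pos_cvg_boundary r1) (power_mean_pos_cvg_gt0 a0)).
  by near=> t; apply: h.
by rewrite ler_expR lerN2 ler_pM2l ?ln_gt0 ?ltr1n// lef_pV2 ?posrE//
  boundary_exponent_gt0.
Unshelve. all: by end_near. Qed.

Lemma exponent_bound_gtN1 op r : -1 < r ->
  exponent_bound op r = op ((r + 2) / 3) (boundary_exponent r).
Proof.
move=> r1; rewrite /exponent_bound /boundary_exponent leNgt r1/=.
by have [->|//] := eqVneq; rewrite add0r.
Qed.

Lemma pittenger r : forall a b, 0 < a -> 0 < b ->
  power_mean_pos (r1 r) a b <= log_mean_pos r a b /\
  log_mean_pos r a b <= power_mean_pos (r2 r) a b.
Proof.
set s := (r + 2) / 3.
have sE : 3 * s = r + 2 by rewrite /s; field.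
have [rN1|r1N] := leP r (-1).
  (* For [r <= -1] both [r + s] and [s - 1] are negative, so s (r + s) (s - 1) has the sign of [s];
     for the exponent 0 the corresponding product vanishes. *)
  rewrite /r1 /r2 /exponent_bound rN1 -/s; have [s0|s0] := leP s 0.
    split.
    - apply: power_le_log_mean_pos => //; apply: logM_le_logL; first by rewrite sE.
      rewrite -mulrA mulr_le0_ge0// mulr_le0//; lra.
    - apply: log_mean_pos_le_power => //; apply: logL_le_logM; first lra.
      by rewrite !mul0r.
  split.
  - apply: power_le_log_mean_pos => //; apply: logM_le_logL; first lra.
    by rewrite !mul0r.
  - apply: log_mean_pos_le_power => //; apply: logL_le_logM; first by rewrite sE.
    rewrite -mulrA mulr_ge0 ?(ltW s0)// mulr_le0//; lra.
rewrite /r1 /r2 !exponent_bound_gtN1// -/s.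
have s0 : 0 < s by lra.
(* This sign decides on which side of [L_r] the mean of exponent [s] lies. That comparison orders
   [s] and the boundary exponent, which resolves the minimum and maximum and supplies the hypothesis
   of [gap_boundary_exponent] for the other side. *)
have [h|h] := leP (s * (r + s) * (s - 1)) 0.
  have sL : forall a b, 0 < a -> 0 < b ->
      power_mean_pos s a b <= log_mean_pos r a b.
    by apply: power_le_log_mean_pos; apply: logM_le_logL => //; rewrite sE.
  have sb := le_boundary_exponent r1N s0 sL.
  rewrite min_l// max_r// => a b a0 b0; split; first exact: sL.
  apply: log_mean_pos_le_power => // x x0; rewrite -subr_le0.
  rewrite -[leLHS]mul1r; apply: gap_boundary_exponent => //; lra.
have sL : forall a b, 0 < a -> 0 < b ->
    log_mean_pos r a b <= power_mean_pos s a b.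
  by apply: log_mean_pos_le_power; apply: logL_le_logM; rewrite ?sE// ltW.
have sb := boundary_exponent_le r1N s0 sL.
rewrite min_r// max_l// => a b a0 b0; split; last exact: sL.
apply: power_le_log_mean_pos => // x x0; rewrite -subr_ge0 -oppr_le0.
rewrite -mulN1r; apply: gap_boundary_exponent => //; lra.
Qed.

End Pittenger.

(* Unlike in [ge0_le_integral], no measurability is assumed. *)
Lemma ge0_le_integralT (R : realType) (d : measure_display)
    (T : measurableType d) (mu : {measure set T -> \bar R}) (f g : T -> \bar R) :
  (forall x, 0 <= f x)%E -> (forall x, f x <= g x)%E ->
  (\int[mu]_x f x <= \int[mu]_x g x)%E.
Proof.
move=> f0 fg; rewrite !ge0_integralTE//; last first.
  by move=> x; exact: le_trans (fg x).
apply: le_ereal_sup => _ [h hf <-]; exists h => // x.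
exact: le_trans (hf x) (fg x).
Qed.

Theorem theorem4 (R : realType) (d : measure_display) (T : measurableType d)
    (mu : {sigma_finite_measure set T -> \bar R}) (p q : T -> R)
    (hp : densities mu p) (hq : densities mu q) (r : R) :
  (power_divergence mu (r1 r) p q <= log_divergence mu r p q)%E /\
  (log_divergence mu r p q <= power_divergence mu (r2 r) p q)%E.
Proof.
have [_ p0 _] := hp; have [_ q0 _] := hq.
(* Densities may vanish, so nonnegativity and the comparison are needed on the closed quadrant,
   where they follow from the open one by passing to the limit. *)
split; apply: ge0_le_integralT => x; rewrite lee_fin.
- apply: extend_cont_ge0 => // [a b a0 b0|].
    by have /andP[] := power_mean_pos_bound (r1 r) a0 b0.
  exact: power_mean_boundary_cvg.
- apply: extend_cont_le => // [a b a0 b0||].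
  + by have [] := pittenger r a0 b0.
  + exact: power_mean_boundary_cvg.
  + exact: log_mean_boundary_cvg.
- apply: extend_cont_ge0 => // [a b a0 b0|].
    by have /andP[] := log_mean_pos_bound r a0 b0.
  exact: log_mean_boundary_cvg.
- apply: extend_cont_le => // [a b a0 b0||].
  + by have [] := pittenger r a0 b0.
  + exact: log_mean_boundary_cvg.
  + exact: power_mean_boundary_cvg.
Qed.
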